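(* Let $G=(V,E)$ be a finite connected simple graph of order $n\ge 2$ with maximum degree $\delta_1$, minimum degree $\delta_n$ and algebraic connectivity $\mu$. For every integer $k\in\{-\delta_n,\dots,\delta_1\}$ such that $G$ contains a defensive $k$-alliance, $$a_k(G)\ge\left\lceil\frac{n(\mu+k+1)}{n+\mu}\right\rceil .$$
   Context: The algebraic connectivity $\mu$ of $G$ is the second smallest eigenvalue (counted with multiplicity) of the Laplacian matrix of $G$. For a set $X\subseteq V$ and $v\in V$, $\delta_X(v)$ denotes the number of neighbors of $v$ in $X$, and $\bar S=V\setminus S$. For an integer $k$, a nonempty set $S\subseteq V$ is a defensive $k$-alliance in $G$ if $\delta_S(v)\ge \delta_{\bar S}(v)+k$ for every $v\in S$. The defensive $k$-alliance number $a_k(G)$ is the minimum cardinality of a defensive $k$-alliance in $G$. (For $k\le\delta_n$ a defensive $k$-alliance always exists, e.g. $S=V$.) *)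

(* Defs.v *)
From mathcomp Require Import all_boot all_order all_algebra.
From mathcomp Require Import polyrcf.

Set Implicit Arguments.
Unset Strict Implicit.
Unset Printing Implicit Defensive.

Import Order.TTheory GRing.Theory Num.Theory.
Local Open Scope ring_scope.

Section Graph.

(* [e] is the adjacency relation of a graph on [T]; that the graph is simple
   ([e] symmetric and irreflexive) is left to the theorems using it. *)
Variables (T : finType) (e : rel T).

Definition degree_in (X : {set T}) (v : T) : nat := #|[set u in X | e v u]|.

Definition degree (v : T) : nat := degree_in setT v.

Definition max_degree : nat := \max_(v : T) degree v.

(* The default #|T| is harmless: every degree in a loopless graph is < #|T|. *)
Definition min_degree : nat := \big[minn/#|T|]_(v : T) degree v.

Definition laplacian (R : nzRingType) : 'M[R]_#|T| :=
  \matrix_(i, j) (if i == j then (degree (enum_val i))%:R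
                  else - (e (enum_val i) (enum_val j))%:R).

Definition defensive_alliance (k : int) (S : {set T}) : bool :=
  (S != set0) &&
  [forall v in S, (degree_in (~: S) v)%:Z + k <= (degree_in S v)%:Z].

(* Meaningful only when some defensive k-alliance exists; #|T| otherwise. *)
Definition alliance_number (k : int) : nat :=
  \big[minn/#|T|]_(S : {set T} | defensive_alliance k S) #|S|.

End Graph.

(* The real eigenvalues of A in nondecreasing order, each repeated according
   to its multiplicity as a root of the characteristic polynomial; [rootsR]
   lists the distinct roots. *)
Definition eigenvalues (R : rcfType) (n : nat) (A : 'M[R]_n) : seq R :=
  let p := char_poly A in
  sort <=%R (flatten [seq nseq (mup x p) x | x <- rootsR p]).

Definition algebraic_connectivity (R : rcfType) (T : finType) (e : rel T) : R :=
  (eigenvalues (laplacian e R))`_1.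

(* Main.v *)
Require Import Defs.
From mathcomp Require Import all_boot all_order all_algebra.
From mathcomp Require Import polyrcf complex reals.
From mathcomp Require Import ring lra.

Set Implicit Arguments.
Unset Strict Implicit.
Unset Printing Implicit Defensive.

Import Order.TTheory GRing.Theory Num.Theory.
Local Open Scope ring_scope.

(** The theorem compares two estimates of the number of edges leaving a
defensive k-alliance S, of cardinality s, in a graph with n vertices.

From above, a vertex of S has at most s - 1 neighbors inside S, so the alliance
condition leaves it at most s - 1 - k neighbors outside; summing over S, at most
s (s - 1 - k) edges leave S ([defensive_alliance_cut]).

From below, the Laplacian L is a symmetric positive semidefinite matrix that
vanishes on constant vectors, and twice its quadratic form is the sum of
(f v - f u)^2 over the ordered pairs of adjacent vertices ([laplacian_form]).
On the orthogonal complement of the constants that form is at least mu times the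
squared norm ([second_eigenvalue_rayleigh]). For a general f one subtracts the
mean, which leaves the form unchanged ([fiedler_inequality]). Applied to the
indicator of S, this says that at least mu s (n - s) / n edges leave S
([cut_lower_bound]).

Hence mu s (n - s) / n <= s (s - 1 - k). Dividing by s and solving for s gives
n (mu + k + 1) <= s (n + mu), and n + mu > 0 because mu >= 0.

The bound on the quadratic form rests on the spectral theorem. It is applied to
the complexification of the matrix, where it gives a unitary eigenbasis with
real eigenvalues; the characteristic polynomial then splits over the reals, and
its roots, counted with multiplicity, are these eigenvalues
([symmetric_eigenbasis]). *)

(** * Spectrum of a real symmetric matrix *)

Lemma char_poly_conj (F : fieldType) n (P D : 'M[F]_n) :
  P \in unitmx -> char_poly (invmx P *m D *m P) = char_poly D.
Proof.
move=> Pu; rewrite /char_poly /char_poly_mx.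
have PK : map_mx polyC (invmx P) *m map_mx polyC P = 1%:M.
  by rewrite -map_mxM mulVmx // map_mx1.
have -> : 'X%:M - map_mx polyC (invmx P *m D *m P) =
    map_mx polyC (invmx P) *m ('X%:M - map_mx polyC D) *m map_mx polyC P.
  by rewrite mulmxBr mulmxBl scalar_mxC -(mulmxA 'X%:M) PK mulmx1 !map_mxM.
by rewrite !det_mulmx mulrAC -det_mulmx PK det1 mul1r.
Qed.

Lemma perm_eigenvalues (R : rcfType) n (A : 'M[R]_n) (s : seq R) :
  char_poly A = \prod_(a <- s) ('X - a%:P) -> perm_eq (eigenvalues A) s.
Proof.
move=> charA; rewrite perm_sort.
have p_neq0 : char_poly A != 0 by rewrite monic_neq0 ?char_poly_monic.
set p := char_poly A in charA p_neq0 *.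
apply/allP => a _ /=; apply/eqP.
rewrite count_flatten -map_comp sumnE big_map.
have mup_s : mup a p = count_mem a s by rewrite charA mu_prod_XsubC.
rewrite -mup_s.
under eq_bigr => b _ do rewrite /= count_nseq /=.
have := roots_on_rootsR p_neq0 a; rewrite /=.
case: (boolP (root p a)) => ra /esym a_in; last first.
  rewrite (mupNroot ra); apply: big1_seq => b /andP[_ b_in].
  by case: eqP b_in => [->|]; rewrite ?a_in // mul0n.
rewrite (bigD1_seq a) ?uniq_roots //= eqxx mul1n big1 ?addn0 // => b.
by move/negPf=> ->; rewrite mul0n.
Qed.

(** The eigenbasis itself stays hidden: [c x i] is the coordinate of [x] along
the [i]-th vector of a complex orthonormal eigenbasis of [A]. The three
conclusions (list of eigenvalues, Parseval identity, diagonal action) are all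
that Rayleigh quotients need. Coordinates are complex because the unitary
diagonalization of the complexified matrix need not be real. *)
Lemma symmetric_eigenbasis (R : rcfType) n (A : 'M[R]_n) : A^T = A ->
  exists (d : 'I_n -> R) (c : 'rV[R]_n -> 'I_n -> R[i]),
    [/\ perm_eq (eigenvalues A) [seq d i | i <- enum 'I_n],
        forall x y, ((x *m y^T) 0 0)%:C%C = \sum_i c x i * (c y i)^*
      & forall x i, c (x *m A) i = (d i)%:C%C * c x i].
Proof.
move=> Asym; pose toC := real_complex R.
have toC_real (a : R) : toC a \is Num.real by rewrite complex_real.
have toC_conj m p (B : 'M[R]_(m, p)) : map_mx Num.conj (map_mx toC B) = map_mx toC B.
  by apply/matrixP => i j; rewrite !mxE; exact/CrealP.
pose AC := map_mx toC A.
have herm : AC \is hermsymmx.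
  apply: realsym_hermsym.
    apply/is_hermitianmxP; rewrite expr0 scale1r map_mx_id //.
    by rewrite /AC -[in LHS]Asym map_trmx.
  by apply/mxOverP => i j; rewrite mxE.
have dreal := hermitian_spectral_diag_real herm.
have Puni := spectral_unitarymx AC; have Punit := unitarymx_unit Puni.
have /hermitian_normalmx/orthomx_spectralP defA := herm.
move: Puni Punit defA dreal.
set P := spectralmx AC; set dC := spectral_diag AC => Puni Punit defA dreal.
pose d i := complex.Re (dC 0 i).
have dE i : dC 0 i = toC (d i).
  by rewrite [RHS]RRe_real //; exact: (mxOverP dreal).
exists d, (fun x i => (map_mx toC x *m invmx P) 0 i); split.
- apply: perm_eigenvalues; apply: (map_poly_inj toC).
  rewrite map_char_poly -/AC defA char_poly_conj // char_poly_trig; last first.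
    exact: diag_mx_is_trig.
  rewrite rmorph_prod big_map big_enum /=.
  by apply: eq_bigr => i _; rewrite mxE eqxx mulr1n dE rmorphB /= map_polyX map_polyC.
- move=> x y; transitivity ((map_mx toC x *m (map_mx toC y)^T) 0 0).
    by rewrite map_trmx -map_mxM [RHS]mxE.
  have -> : map_mx toC x *m (map_mx toC y)^T = (map_mx toC x *m invmx P)
     *m map_mx Num.conj (map_mx toC y *m invmx P)^T.
    rewrite trmx_mul map_mxM {2}invmx_unitary // trmxCK map_trmx toC_conj.
    by rewrite mulmxA mulmxKV.
  by rewrite mxE; apply: eq_bigr => i _; rewrite !mxE.
- move=> x i; rewrite map_mxM -/AC {1}defA !mulmxA mulmxK //.
  by rewrite mul_mx_diag !mxE dE mulrC.
Qed.
(** An eigenvector [v] for [a] gives the value [a * |v|^2] to the form. *)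
Lemma eigenvalues_ge0 (R : rcfType) n (A : 'M[R]_n) (a : R) :
  (forall x : 'rV_n, 0 <= (x *m A *m x^T) 0 0) -> a \in eigenvalues A -> 0 <= a.
Proof.
move=> psd; rewrite mem_sort => /flattenP[_ /mapP[b b_root ->] /nseqP[-> _]].
have p_neq0 : char_poly A != 0 by rewrite monic_neq0 ?char_poly_monic.
have := roots_on_rootsR p_neq0 b; rewrite /= b_root -eigenvalue_root_char.
case/eigenvalueP=> v vA v_neq0; have := psd v; rewrite vA -scalemxAl mxE.
rewrite pmulr_lge0 // mxE; have [i vi_neq0] : exists i, v 0 i != 0.
  by apply/rV0Pn.
rewrite (bigD1 i) //= ltr_wpDr ?mxE -?expr2 ?exprn_even_gt0 //.
by apply: sumr_ge0 => j _; rewrite mxE -expr2 sqr_ge0.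
Qed.

(** The eigenbasis comes in no particular order, so the eigenvalue at position 0
of the sorted list has to be located among the [d i]; removing that one index
leaves the tail of the list. *)
Lemma second_smallest_le (R : realDomainType) n (s : seq R) (d : 'I_n -> R) :
  sorted <=%R s -> perm_eq s [seq d i | i <- enum 'I_n] -> s != [::] ->
  exists i0, forall i, i != i0 -> s`_1 <= d i.
Proof.
case: s => [//|a r] /= sorted_r perm_d _.
have /mapP[i0 _ a_d] : a \in [seq d i | i <- enum 'I_n].
  by rewrite -(perm_mem perm_d) mem_head.
exists i0 => i i_neq; have perm_r : perm_eq r [seq d j | j <- rem i0 (enum 'I_n)].
  rewrite -(perm_cons a) (permPl perm_d) {1}a_d.
  by apply: (perm_map d (t := i0 :: _)); rewrite perm_to_rem ?mem_enum.
have : d i \in r.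
  rewrite (perm_mem perm_r) map_f // mem_rem_uniq ?enum_uniq //.
  by rewrite !inE i_neq mem_enum.
case: r sorted_r {perm_d perm_r} => [//|b r] /= /andP[_ b_r].
rewrite inE => /predU1P[-> //|]; move: (d i); apply/allP.
by move: b_r; rewrite path_sortedE; [case/andP | exact: le_trans].
Qed.

(** If the second eigenvalue [mu] is positive, all eigenvalues but one, of index
[i0], are at least [mu]. The isotropic vector [u] then lies on the [i0]-th
axis, so [x], being orthogonal to [u], has no [i0]-th coordinate, and only
eigenvalues at least [mu] contribute to the form at [x]. If [mu <= 0], the
inequality follows from semidefiniteness alone. *)
Lemma second_eigenvalue_rayleigh (R : rcfType) n (A : 'M[R]_n) (u x : 'rV[R]_n) :
    A^T = A -> (forall y : 'rV_n, 0 <= (y *m A *m y^T) 0 0) ->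
    u != 0 -> (u *m A *m u^T) 0 0 = 0 -> (x *m u^T) 0 0 = 0 ->
  (eigenvalues A)`_1 * (x *m x^T) 0 0 <= (x *m A *m x^T) 0 0.
Proof.
move=> Asym psd u_neq0 uAu xu; set mu := _`_1.
have dot_ge0 (y : 'rV[R]_n) : 0 <= (y *m y^T) 0 0.
  by rewrite mxE sumr_ge0 // => i _; rewrite mxE -expr2 sqr_ge0.
have [mu_le0|mu_gt0] := lerP mu 0.
  by rewrite (le_trans _ (psd x)) // mulr_le0_ge0.
have [d [c [d_eig c_dot c_A]]] := symmetric_eigenbasis Asym.
have c_form y : ((y *m A *m y^T) 0 0)%:C%C = \sum_i (d i)%:C%C * `|c y i| ^+ 2.
  by rewrite c_dot; apply: eq_bigr => i _; rewrite c_A normCK mulrA.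
have d_ge0 i : 0 <= d i.
  by apply: (eigenvalues_ge0 psd); rewrite (perm_mem d_eig) map_f ?mem_enum.
have [i0 d_ge_mu] : exists i0, forall i, i != i0 -> mu <= d i.
  apply: second_smallest_le d_eig _; first exact/sort_sorted/le_total.
  by apply: contraTneq mu_gt0; rewrite /mu => ->; rewrite ltxx.
(* The terms of the form at [u] are nonnegative with sum 0, so each vanishes. *)
have cu0 i : i != i0 -> c u i = 0.
  move=> /d_ge_mu/(lt_le_trans mu_gt0) di_gt0.
  have term_ge0 j : true -> 0 <= (d j)%:C%C * `|c u j| ^+ 2.
    by move=> _; rewrite mulr_ge0 ?exprn_ge0 // ler0c.
  have := c_form u; rewrite uAu => /esym/(psumr_eq0P term_ge0) term_eq0.
  by have /eqP := term_eq0 i isT; rewrite mulf_eq0 expf_eq0 normr_eq0 => /orP[/eqP/complexI di0|/eqP//];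
     rewrite di0 ltxx in di_gt0.
(* [u] lives on the axis [i0] and is nonzero: orthogonality kills [c x i0]. *)
have cx0 : c x i0 = 0.
  move: (c_dot x u); rewrite xu (bigD1 i0) //= big1 ?addr0; last first.
    by move=> i /cu0->; rewrite conjC0 mulr0.
  move/esym/eqP; rewrite mulf_eq0 conjC_eq0 => /orP[/eqP//|/eqP cui0].
  have /rV0Pn[j uj_neq0] := u_neq0.
  have /complexI uu0 : ((u *m u^T) 0 0)%:C%C = 0%:C%C.
    rewrite c_dot big1 // => i _.
    by have [->|/cu0->] := eqVneq i i0; rewrite ?cui0 mul0r.
  have coord_ge0 i : true -> 0 <= u 0 i * u^T i 0.
    by move=> _; rewrite mxE -expr2 sqr_ge0.
  move: uu0; rewrite mxE => /(psumr_eq0P coord_ge0) coord_eq0.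
  by have /eqP := coord_eq0 j isT; rewrite mxE mulf_eq0 orbb (negPf uj_neq0).
rewrite -lecR c_form rmorphM /= c_dot mulr_sumr ler_sum // => i _.
rewrite -normCK; have [->|/d_ge_mu mu_le] := eqVneq i i0.
  by rewrite cx0 normr0 expr0n !mulr0.
by rewrite ler_wpM2r ?exprn_ge0 // lecR.
Qed.

(** * The Laplacian form and Fiedler's inequality *)

Section Laplacian.
Variables (R : rcfType) (T : finType) (e : rel T).
Hypotheses (e_sym : symmetric e) (e_irr : irreflexive e).
Implicit Types (f : T -> R) (S X : {set T}).

Definition vertex_row f : 'rV[R]_#|T| := \row_i f (enum_val i).

(** The sum runs over ordered pairs, so each edge counts twice: this is twice the
Laplacian form. *)
Definition dirichlet f : R := \sum_v \sum_u (e v u)%:R * (f v - f u) ^+ 2.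

Lemma sum_enum_val f : \sum_(i < #|T|) f (enum_val i) = \sum_v f v.
Proof. by rewrite -(big_enum_val (A := T)). Qed.

Lemma vertex_row_dot f g :
  (vertex_row f *m (vertex_row g)^T) 0 0 = \sum_v f v * g v.
Proof. by rewrite mxE -sum_enum_val; apply: eq_bigr => i _; rewrite !mxE. Qed.

Lemma degree_inE X v : (degree_in e X v)%:R = \sum_(u in X) (e v u)%:R :> R.
Proof.
rewrite /degree_in -sum1_card natr_sum big_mkcond [RHS]big_mkcond /=.
by apply: eq_bigr => u _; rewrite !inE; case: (u \in X); case: (e v u).
Qed.

Lemma laplacian_sym : (laplacian e R)^T = laplacian e R.
Proof.
by apply/matrixP => i j; rewrite !mxE eq_sym e_sym; case: eqVneq => // ->.
Qed.

Lemma laplacian_form f :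
  (vertex_row f *m laplacian e R *m (vertex_row f)^T) 0 0 *+ 2 = dirichlet f.
Proof.
have col u : \sum_v f v * (if v == u then (degree e v)%:R else - (e v u)%:R)
    = f u * \sum_v (e u v)%:R - \sum_v f v * (e v u)%:R.
  have -> : \sum_v (e u v)%:R = (degree e u)%:R :> R.
    by rewrite /degree degree_inE; apply: eq_bigl => v; rewrite in_setT.
  rewrite (bigD1 u) //= eqxx.
  congr (_ + _); rewrite [in RHS](bigD1 u) //= e_irr mulr0 add0r -sumrN.
  by apply: eq_bigr => v /negPf->; rewrite mulrN.
have -> : (vertex_row f *m laplacian e R *m (vertex_row f)^T) 0 0 =
   \sum_u \sum_v ((e u v)%:R * f u ^+ 2 - (e u v)%:R * (f u * f v)).
  rewrite mxE -[RHS]sum_enum_val; apply: eq_bigr => j _; rewrite !mxE.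
  rewrite sumrB -mulr_suml.
  have := col (enum_val j); rewrite -sum_enum_val => colj.
  under eq_bigr => i _ do rewrite !mxE -(inj_eq enum_val_inj).
  rewrite colj mulrBl; congr (_ - _); first by ring.
  by rewrite mulr_suml; apply: eq_bigr => v _; rewrite e_sym; ring.
rewrite mulr2n {1}exchange_big /= -big_split; apply: eq_bigr => u _ /=.
by rewrite -big_split; apply: eq_bigr => v _ /=; rewrite e_sym; ring.
Qed.

Lemma dirichlet_ge0 f : 0 <= dirichlet f.
Proof.
by do 2![apply: sumr_ge0 => ? _]; rewrite mulr_ge0 ?sqr_ge0 ?ler0n.
Qed.

Lemma laplacian_psd (x : 'rV[R]_#|T|) :
  0 <= (x *m laplacian e R *m x^T) 0 0.
Proof.
have -> : x = vertex_row (fun v => x 0 (enum_rank v)).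
  by apply/rowP => i; rewrite mxE enum_valK.
by rewrite -(pmulrn_lge0 _ (isT : (0 < 2)%N)) laplacian_form dirichlet_ge0.
Qed.

Lemma algebraic_connectivity_ge0 : 0 <= algebraic_connectivity R e.
Proof.
rewrite /algebraic_connectivity; set s := eigenvalues _.
have [s_small|s_big] := leqP (size s) 1; first by rewrite nth_default.
exact: (eigenvalues_ge0 laplacian_psd (mem_nth 0 s_big)).
Qed.

(** The left-hand factor is the squared norm of [f] minus its mean; both sides are
unchanged when a constant is added to [f], which reduces the claim to functions
of mean 0, that is, orthogonal to the constants. *)
Lemma fiedler_inequality f : (0 < #|T|)%N ->
  algebraic_connectivity R e *
    (\sum_v f v ^+ 2 - (\sum_v f v) ^+ 2 / #|T|%:R) *+ 2 <= dirichlet f.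
Proof.
move=> n_gt0; have n_neq0 : #|T|%:R != 0 :> R by rewrite pnatr_eq0 -lt0n.
pose m := (\sum_v f v) / #|T|%:R; pose g v := f v - m.
have -> : dirichlet f = dirichlet g.
  by do 2![apply: eq_bigr => ? _]; rewrite /g; congr (_ * _ ^+ 2); ring.
have sum_const (a : R) : \sum_(v : T) a = a * #|T|%:R.
  by rewrite sumr_const mulr_natr.
have sum_g : \sum_v g v = 0.
  by rewrite sumrB sum_const /m mulfVK // subrr.
have -> : \sum_v f v ^+ 2 - (\sum_v f v) ^+ 2 / #|T|%:R = \sum_v g v * g v.
  have -> : \sum_v g v * g v = \sum_v (f v ^+ 2 - (m *+ 2) * f v + m ^+ 2).
    by apply: eq_bigr => v _; rewrite /g; ring.
  rewrite big_split sumrB /= -mulr_sumr sum_const.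
  by rewrite /m; field.
rewrite -laplacian_form lerMn2r /= -vertex_row_dot.
apply: (@second_eigenvalue_rayleigh _ _ _ (vertex_row (fun=> 1))).
- exact: laplacian_sym.
- exact: laplacian_psd.
- case/card_gt0P: n_gt0 => v _; apply/rV0Pn; exists (enum_rank v).
  by rewrite mxE oner_eq0.
- apply: (@pmulrnI _ 2 isT); rewrite /= laplacian_form mul0rn.
  by do 2![apply: big1 => ? _]; rewrite subrr expr0n mulr0.
- by rewrite vertex_row_dot -[RHS]sum_g; apply: eq_bigr => v _; rewrite mulr1.
Qed.

(** * Edges leaving an alliance *)

Lemma dirichlet_indicator S :
  dirichlet (fun v => (v \in S)%:R) = (\sum_(v in S) (degree_in e (~: S) v)%:R) *+ 2.
Proof.
(* [w v u] indicates an edge leaving [S] from [v] to [u]. *)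
pose w v u : R := (v \in S)%:R * ((u \in ~: S)%:R * (e v u)%:R).
have -> : \sum_(v in S) (degree_in e (~: S) v)%:R = \sum_v \sum_u w v u.
  rewrite big_mkcond; apply: eq_bigr => v _; rewrite -mulr_sumr /= degree_inE.
  case: (v \in S); rewrite ?mul0r // mul1r big_mkcond /=.
  by apply: eq_bigr => u _; case: (u \in _); rewrite ?mul0r ?mul1r.
rewrite mulr2n {2}exchange_big -big_split; apply: eq_bigr => v _ /=.
rewrite -big_split; apply: eq_bigr => u _ /=.
rewrite /w !inE [e u v]e_sym.
by case: (v \in S); case: (u \in S); rewrite /=; ring.
Qed.

Lemma cut_lower_bound S : (0 < #|T|)%N ->
  algebraic_connectivity R e * (#|S|%:R - #|S|%:R ^+ 2 / #|T|%:R) <=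
    \sum_(v in S) (degree_in e (~: S) v)%:R.
Proof.
move=> n_gt0; have := fiedler_inequality (fun v => (v \in S)%:R) n_gt0.
rewrite dirichlet_indicator lerMn2r /=.
have cardS : \sum_v (v \in S)%:R = #|S|%:R :> R.
  by rewrite -sum1_card natr_sum [RHS]big_mkcond; apply: eq_bigr => v _; case: ifP.
rewrite cardS.
under eq_bigr => v _ do rewrite -natrX -mulnn mulnb andbb.
by rewrite cardS.
Qed.

(** A vertex of [S] is not its own neighbor, so it has at most [#|S| - 1]
neighbors in [S]. *)
Lemma defensive_alliance_cut (k : int) S : defensive_alliance e k S ->
  \sum_(v in S) (degree_in e (~: S) v)%:R <= #|S|%:R * (#|S|%:R - 1 - k%:~R) :> R.
Proof.
case/andP=> _ /'forall_implyP S_k; rewrite mulr_natl -sumr_const.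
apply: ler_sum => v vS; have := S_k v vS; rewrite -(ler_int R) rmorphD /= => deg_k.
have : (degree_in e S v + 1)%:R <= #|S|%:R :> R.
  rewrite ler_nat (cardsD1 v S) vS addnC leq_add2l subset_leq_card //.
  by apply/subsetP => u; rewrite !inE; case: eqP => [->|]; rewrite ?e_irr ?andbF //= => _ /andP[].
rewrite natrD; move: deg_k; rewrite -!pmulrn; lra.
Qed.

Lemma defensive_alliance_card (k : int) S : defensive_alliance e k S ->
  #|T|%:R * (algebraic_connectivity R e + k%:~R + 1) /
    (#|T|%:R + algebraic_connectivity R e) <= #|S|%:R.
Proof.
move=> S_k; have S_gt0 : (0 < #|S|)%N by case/andP: S_k; rewrite card_gt0.
have n_gt0 : (0 < #|T|)%N by apply: leq_trans S_gt0 (max_card _).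
have := le_trans (cut_lower_bound S n_gt0) (defensive_alliance_cut S_k).
have := algebraic_connectivity_ge0; set mu := algebraic_connectivity R e => mu_ge0.
have nR_gt0 : 0 < #|T|%:R :> R by rewrite ltr0n.
have sR_gt0 : 0 < #|S|%:R :> R by rewrite ltr0n.
set n : R := #|T|%:R in nR_gt0 *; set s : R := #|S|%:R in sR_gt0 *.
have -> : mu * (s - s ^+ 2 / n) = s * (mu * (1 - s / n)) by ring.
rewrite ler_pM2l // -(ler_pM2l nR_gt0).
have -> : n * (mu * (1 - s / n)) = mu * (n - s) by field; rewrite gt_eqF.
by rewrite ler_pdivrMr; [nra | lra].
Qed.

End Laplacian.

Theorem theorem7 (R : realType) (T : finType) (e : rel T)
  (e_sym : symmetric e) (e_irr : irreflexive e)
  (e_conn : forall x y : T, connect e x y)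
  (n_ge2 : (2 <= #|T|)%N)
  (k : int)
  (k_range : - (min_degree e)%:Z <= k <= (max_degree e)%:Z)
  (k_ex : exists S : {set T}, defensive_alliance e k S) :
  let n : R := #|T|%:R in
  let mu : R := algebraic_connectivity R e in
  Num.ceil (n * (mu + k%:~R + 1) / (n + mu)) <= (alliance_number e k)%:Z.
Proof.
rewrite /= ceil_le_int -pmulrn /alliance_number.
have bound S := @defensive_alliance_card R T e e_sym e_irr k S.
(* The default value [#|T|] of the minimum also obeys the bound, since some
   alliance exists and has at most [#|T|] vertices. *)
elim/big_ind: _ => [|a b a_ge b_ge|S /bound //].
- case: k_ex => S /bound/le_trans; apply.
  by rewrite ler_nat max_card.
- by rewrite /minn; case: ifP.
Qed.
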